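(* Let $A$ be a finite abelian group and let $B$ be a subgroup of $A$ of index $2$. Then the number of digraphs $\mathrm{Cay}(A,S)$ with $S\subseteq A\setminus B$, counted up to digraph isomorphism, is at least $2^{\frac{|A|}{2}-(\log_2|A|)^2}-3\cdot 2^{\frac{3|A|}{8}}$. Moreover, among these isomorphism classes, the proportion consisting of DRRs tends to $1$ as $|A|\to\infty$.
   Context: For a finite group $G$ and $S\subseteq G$, the Cayley digraph $\mathrm{Cay}(G,S)$ has vertex set $G$ and an arc $(g,h)$ if and only if $gh^{-1}\in S$. The group $G$ acts regularly on it by right multiplication and is identified with this subgroup of $\mathrm{Aut}(\mathrm{Cay}(G,S))$. $\mathrm{Cay}(G,S)$ is a DRR if $\mathrm{Aut}(\mathrm{Cay}(G,S))=G$. The digraphs $\mathrm{Cay}(A,S)$ with $S\subseteq A\setminus B$ are exactly the bipartite Cayley digraphs over $A$ with bipartition $\{B,A\setminus B\}$. *)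

(* Defs.v *)
From HB Require Import structures.
From mathcomp Require Import all_boot all_order all_algebra all_fingroup.
From mathcomp Require Import reals exp.
Set Implicit Arguments.
Unset Strict Implicit.
Unset Printing Implicit Defensive.

Import GroupScope.

(* A digraph with vertex set the finite type V is given by its set of arcs. *)
Notation digraph V := {set V * V}.

Section Digraph.
Variable V : finType.
Implicit Types (D E F : digraph V) (p q : {perm V}).

Definition is_diso D E (p : {perm V}) : bool :=
  [forall u, forall v, ((p u, p v) \in E) == ((u, v) \in D)].

Definition diso D E : bool := [exists p : {perm V}, is_diso D E p].

Definition diaut D : {set {perm V}} := [set p | is_diso D D p].

Lemma is_disoP D E p :
  reflect (forall u v, ((p u, p v) \in E) = ((u, v) \in D)) (is_diso D E p).
Proof.
apply: (iffP forallP) => [h u v|h u]; first by move/forallP/(_ v)/eqP: (h u).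
by apply/forallP=> v; apply/eqP.
Qed.

Lemma is_diso1 D : is_diso D D 1.
Proof. by apply/is_disoP=> u v; rewrite !perm1. Qed.

Lemma is_disoM D E F p q :
  is_diso D E p -> is_diso E F q -> is_diso D F (p * q).
Proof. by move=> /is_disoP hp /is_disoP hq; apply/is_disoP=> u v; rewrite !permM hq. Qed.

Lemma is_disoV D E p : is_diso D E p -> is_diso E D p^-1.
Proof. by move=> /is_disoP hp; apply/is_disoP=> u v; rewrite -hp !permKV. Qed.

Lemma diso_refl D : diso D D.
Proof. by apply/existsP; exists 1; apply: is_diso1. Qed.

Lemma diso_sym D E : diso D E = diso E D.
Proof.
by apply/existsP/existsP=> -[p /is_disoV]; exists p^-1.
Qed.

Lemma diso_trans D E F : diso D E -> diso E F -> diso D F.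
Proof.
move=> /existsP[p hp] /existsP[q hq]; apply/existsP.
by exists (p * q); apply: is_disoM hp hq.
Qed.

Lemma diso_equivalence : equivalence_rel diso.
Proof.
move=> D E F; split=> [|h]; first exact: diso_refl.
by apply/idP/idP; apply: diso_trans; rewrite // diso_sym.
Qed.

Lemma diaut_group_set D : group_set (diaut D).
Proof.
apply/group_setP; split=> [|p q]; rewrite !inE; first exact: is_diso1.
exact: is_disoM.
Qed.

Canonical diaut_group D := Group (diaut_group_set D).

End Digraph.

Section Cayley.
Variable gT : finGroupType.

Definition cayley (S : {set gT}) : digraph gT :=
  [set a | a.1 * a.2^-1 \in S].

(* The permutations x |-> x * g of gT, for g : gT. *)
Definition right_regular : {group {perm gT}} :=
  (actperm 'R @* [set: gT])%G.

Definition DRR (D : digraph gT) : bool := diaut D == right_regular :> {set _}.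

Lemma right_regular_sub (S : {set gT}) : right_regular \subset diaut (cayley S).
Proof.
apply/subsetP=> _ /morphimP[g _ _ ->]; rewrite inE; apply/is_disoP=> u v.
by rewrite !inE !actpermE /= invMg mulgA mulgK.
Qed.

Definition bipartite_cayley (B : {set gT}) : {set digraph gT} :=
  [set cayley S | S : {set gT} in powerset (~: B)].

Definition bipartite_cayley_classes (B : {set gT}) : {set {set digraph gT}} :=
  equivalence_partition (@diso gT) (bipartite_cayley B).

(* On isomorphic Cayley digraphs over the same group, DRR takes the same value
   (their automorphism groups are conjugate and contain right_regular), so
   each class consists either entirely of DRRs or entirely of non-DRRs. *)
Definition DRR_classes (B : {set gT}) : {set {set digraph gT}} :=
  [set C in bipartite_cayley_classes B | [forall D in C, DRR D]].

End Cayley.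

Definition log2 (R : realType) (x : R) : R := (ln x / ln 2)%R.

(* Main.v *)
(* Write n = |A|, V = A \ B, so |V| = n/2. Let S be a subset of V such that
   Cay(A,S) is not a DRR and let G be minimal among the subgroups of the
   automorphism group properly containing A; let K be the stabiliser of 1 in G.
   If A is normal in G, then S is preserved by a nontrivial automorphism of A,
   which fixes at most |V|/2 points of V. Otherwise A is self-normalising and
   meets its other conjugates in Z = A :&: 'Z(G), and Frobenius' counting shows
   that KZ is the set of elements of G avoiding every conjugate of A \ Z, hence
   normal; so for each a in A \ Z some a k a^-1 (k in K) lies in KZ but not in
   K, which means that on the cosets aZ and a^-1 Z the set S is preserved by a
   nontrivial translation from Z. At most one coset other than Z is its own
   inverse, so the translations are chosen on about half of the cosets. A set is
   thus preserved by one of few permutations each fixing few points of V. In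
   total there are at most 2 n^k 2^(3n/8) exceptional S, where k = floor(log2 n),
   since A has at most n^k automorphisms and at most n^(k-1) proper subgroups.
   Finally an isomorphism between DRRs fixing 1 is an automorphism of A, so each
   class of DRRs contains at most n^k of the digraphs. *)
Require Import Defs.
From HB Require Import structures.
From mathcomp Require Import all_boot all_order all_algebra all_fingroup all_solvable.
From mathcomp Require Import reals exp zify ring lra.

Set Implicit Arguments.
Unset Strict Implicit.
Unset Printing Implicit Defensive.

(** * Factorised groups with an abelian maximal subgroup *)

Section Factorization.
Local Open Scope group_scope.

(** As [a] fixes only 1 in [N], the map x |-> [x, a] is injective on [N], hence onto. So every
    element of [N] has the form y^-1 * y^a, and conjugation by [a] swaps the two factors up to
    inversion because [a ^+ 2 = 1]. *)
Lemma involution_inverts (gT : finGroupType) (N : {group gT}) (a : gT) :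
  a \in 'N(N) -> a ^+ 2 = 1 -> 'C_N[a] = 1 -> {in N, forall x, x ^ a = x^-1}.
Proof.
move=> nNa a2 cNa.
have inj : {in N &, injective (fun x => [~ x, a])}.
  move=> x y Nx Ny /= eq_xy; apply/eqP; rewrite eq_mulgV1; apply/eqP/set1gP.
  rewrite -cNa inE groupM ?groupV //=; apply/cent1P/commgP/conjg_fixP.
  move: eq_xy; rewrite !commgEl => eq_xy.
  by rewrite conjMg conjVg -[x ^ a](mulKVg x) eq_xy mulgA mulgK.
have im : [set [~ x, a] | x in N] = N.
  apply/eqP; rewrite eqEcard (card_in_imset inj) leqnn andbT.
  apply/subsetP=> _ /imsetP[x Nx ->].
  by rewrite commgEl groupM ?groupV ?memJ_norm.
move=> x Nx; have /imsetP[y Ny ->] : x \in [set [~ y, a] | y in N] by rewrite im.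
by rewrite commgEl conjMg conjVg -(conjgM y) -expg2 a2 conjg1 [RHS]invMg invgK.
Qed.

Variables (gT : finGroupType) (G A K : {group gT}).
Hypotheses (defG : A * K = G) (tiAK : A :&: K = 1) (cAA : abelian A).
Hypothesis maxA :
  forall H : {group gT}, A \proper H -> H \subset G -> G \subset H.
Hypothesis nnA : ~~ (G \subset 'N(A)).
Hypothesis coreK :
  forall L : {group gT}, L \subset K -> G \subset 'N(L) -> L :=: 1.

Let Z := (A :&: 'Z(G))%G.

Let sAG : A \subset G. Proof. by rewrite -defG mulG_subl. Qed.
Let sKG : K \subset G. Proof. by rewrite -defG mulG_subr. Qed.

Let cZ x : x \in Z -> {in G, forall y, commute x y}.
Proof. by case/setIP=> _ /centerP[_]. Qed.

Let memZ a : a \in A -> K \subset 'C[a] -> a \in Z.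
Proof.
move=> Aa cKa; rewrite inE Aa /=; apply/centerP; split; first exact: (subsetP sAG).
move=> y; rewrite -defG => /mulsgP[b k Ab Kk ->].
apply: commuteM; first by apply: (centsP cAA).
by apply: cent1P; rewrite cent1C (subsetP cKa).
Qed.

(** By maximality [A] is its own normaliser in [G], so [A] and [A :^ g^-1] differ and together
    generate [G]. Both are abelian and contain [a], which is therefore central. *)
Lemma factor_conj_mem a g : a \in A -> g \in G -> a ^ g \in A -> g \notin A -> a \in Z.
Proof.
move=> Aa Gg Aag nAg.
have prA : A \proper A <*> (A :^ g^-1).
  rewrite properE joing_subl /= join_subG subxx /=; apply: contra nnA => sAA.
  have nAg' : g \in 'N(A).
    rewrite -groupV inE; exact: sAA.
  apply: subset_trans (maxA (H := 'N_G(A)%G) _ (subsetIl _ _)) (subsetIr _ _).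
  rewrite properE subsetI sAG normG /=; apply/subsetPn; exists g => //.
  by rewrite inE Gg.
have sHG : A <*> (A :^ g^-1) \subset G.
  by rewrite join_subG sAG /= sub_conjgV conjGid.
have sG := maxA prA sHG.
rewrite inE Aa /=; apply/centerP; split; first exact: (subsetP sAG).
suff : G \subset 'C[a] by move=> /subsetP h y /h /cent1P.
apply: subset_trans sG _; rewrite join_subG !sub_cent1; apply/andP; split.
  exact: (subsetP cAA).
have cAA' : abelian (A :^ g^-1) by rewrite abelianJ.
by apply: (subsetP cAA'); rewrite mem_conjgV.
Qed.

Lemma factor_center_proper : Z \proper A.
Proof.
rewrite properE subsetIl /=; apply: contra nnA; rewrite subsetI => /andP[_ h].
apply: cents_norm; rewrite centsC; apply: subset_trans h _; exact: subsetIr.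
Qed.

Let sZK_G : K * Z \subset G.
Proof. by rewrite mul_subG // subIset // sAG. Qed.

(* Frobenius' counting argument: the conjugates of [A] meet pairwise in [Z], so the elements of [G] outside every conjugate of [A :\: Z] are [#|K| * #|Z|] in number, hence they are exactly those of [K * Z]. *)
Lemma factor_kernel_norm : G \subset 'N(K * Z).
Proof.
have nTI : normedTI (A :\: Z) G A.
  apply/normedTI_memJ_P; split=> //.
    have := factor_center_proper.
    by case/properP=> _ [x Ax nZx]; apply/set0Pn; exists x; rewrite inE nZx.
  move=> a g /setDP[Aa nZa] Gg; rewrite !inE.
  apply/idP/idP=> [/andP[_ Aag]|Ag].
    by apply: contraR nZa => nAg; apply: factor_conj_mem Aag nAg.
  rewrite conjgE (centsP cAA a Aa g Ag) mulKg Aa andbT.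
  by move: nZa; rewrite !inE Aa.
have cardG : #|G| = (#|A| * #|K|)%N by rewrite -defG TI_cardMg.
have iGA : #|G : A| = #|K|.
  by apply/eqP; rewrite -(eqn_pmul2l (cardG_gt0 A)) Lagrange // cardG.
have defKZ : K * Z = G :\: class_support (A :\: Z) G.
  apply/eqP; rewrite eqEcard; apply/andP; split; last first.
    rewrite cardsD (setIidPr _); last first.
      rewrite class_supportEr; apply/bigcupsP=> x Gx.
      by rewrite -(conjGid Gx) conjSg subDset subsetU // sAG orbT.
    rewrite (card_support_normedTI nTI) iGA cardsD (setIidPr _) ?subsetIl //.
    rewrite TI_cardMg; last first.
      by apply/trivgP; rewrite -tiAK [in X in _ \subset X]setIC setIS // subsetIl.
    by rewrite cardG mulnBl subKn ?leq_mul2r ?subset_leq_card ?subsetIl ?orbT // mulnC.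
  (* If k * z = a ^ g with g = b * h, b in [A], h in [K], then k ^ h^-1 is a conjugate of a * z^-1
     by an element of [A]. It lies in [A :&: K], so it is 1 and a = z. *)
  apply/subsetP=> x KZx; rewrite inE (subsetP sZK_G) // andbT.
  apply/negP=> /imset2P[a g /setDP[Aa nZa] Gg def]; case/negP: nZa.
  case/mulsgP: KZx def => k z Kk Zz -> def.
  have zg : z ^ g = z by rewrite conjgE (cZ Zz Gg) mulKg.
  have {def} def : k = (a * z^-1) ^ g.
    by rewrite conjMg conjVg -def zg mulgK.
  move: Gg; rewrite -defG => /mulsgP[b h Ab Kh dg].
  have Aaz : a * z^-1 \in A by rewrite groupM ?groupV //; case/setIP: Zz.
  have : k ^ h^-1 \in A :&: K.
    rewrite inE andbC groupJ ?groupV //= def dg conjgM conjgK.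
    by rewrite groupJ.
  rewrite tiAK => /set1P/eqP; rewrite conjg_eq1 def conjg_eq1 -eq_mulgV1.
  by move/eqP->.
rewrite defKZ; apply/subsetP=> g Gg; rewrite inE; apply/subsetP=> x.
rewrite mem_conjg !inE => /andP[nx Gx]; rewrite -(groupJr x (groupVr Gg)) Gx andbT.
apply: contra nx => /imset2P[a y Aa Gy ->].
by apply/imset2P; exists a (y * g^-1); rewrite ?conjgM ?groupM ?groupV.
Qed.

Let KZconj x g : x \in K * Z -> g \in G -> x ^ g \in K * Z.
Proof. by move=> KZx Gg; rewrite memJ_norm // (subsetP factor_kernel_norm). Qed.

(** If [a] normalised [K], then [K, a] would be a normal subgroup of [G] inside [K], hence trivial,
    and [a] would be central. So some conjugate of k leaves [K], while staying in the normal set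
    [K * Z]. *)
Lemma factor_twist a : a \in A -> a \notin Z ->
  exists k k' z, [/\ k \in K, k' \in K, z \in Z & z != 1 /\ k ^ a^-1 = k' * z].
Proof.
move=> Aa nZa.
have Ga := subsetP sAG a Aa.
suff /subsetPn[x] : ~~ (K :^ a^-1 \subset K).
  case/imsetP=> k Kk -> nK; have : k ^ a^-1 \in K * Z.
    by apply: KZconj; rewrite ?groupV //; apply/mulsgP; exists k 1; rewrite ?mulg1 ?group1.
  case/mulsgP=> k' z Kk' Zz def; exists k, k', z; split=> //; split=> //.
  by apply: contraNneq nK => z1; rewrite def z1 mulg1.
apply: contra nZa => nKa; apply: memZ => //.
have {}nKa : a \in 'N(K) by rewrite -groupV inE.
(* [[K, a]] is normalised by [A] because [K :^ b \subset K * Z] and [Z] is central. *)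
have L1 : [~: K, <[a]>] = 1.
  apply: (coreK (L := [~: K, <[a]>]%G)); first by rewrite commg_subl cycle_subG.
  rewrite -defG mul_subG ?commg_norml //; apply/subsetP=> b Ab.
  rewrite inE -genJ gen_subG.
  apply/subsetP=> _ /imsetP[_ /imset2P[k c Kk ca ->] ->].
  have Ac : c \in A by apply: subsetP ca; rewrite cycle_subG.
  have cb : c ^ b = c by rewrite conjgE (centsP cAA c Ac b Ab) mulKg.
  rewrite conjRg cb.
  have : k ^ b \in K * Z.
    by apply: KZconj; rewrite ?(subsetP sAG) //; apply/mulsgP; exists k 1; rewrite ?mulg1 ?group1.
  case/mulsgP=> k' z Kk' Zz ->; rewrite commMgJ.
  have -> : [~ z, c] = 1 by apply/eqP/commgP/cZ => //; apply: (subsetP sAG).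
  rewrite mulg1 conjgE -(cZ Zz) ?mulKg ?mem_commg //.
  by rewrite groupR ?(subsetP sAG c Ac) ?(subsetP sKG k' Kk').
have /commG1P : [~: K, <[a]>] = 1 by [].
by rewrite cent_cycle.
Qed.

(** Modulo [Z], elements of [A] outside [Z] act on [K / Z] without fixed points, so those with
    square in [Z] act by inversion. A product of two inversions acts trivially; if it were also
    fixed-point-free, [K / Z] would be trivial and [G] would normalise [A]. *)
Lemma factor_involution a b : a \in A -> b \in A -> a \notin Z -> b \notin Z ->
  a ^+ 2 \in Z -> b ^+ 2 \in Z -> a * b \in Z.
Proof.
move=> Aa Ab nZa nZb a2 b2.
have nZG : G \subset 'N(Z).
  by apply: cents_norm; apply/centsP=> x Gx y Zy; apply/esym/cZ.
have sAN := subset_trans sAG nZG.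
have sKN := subset_trans sKG nZG.
(* A fixed coset of k gives [c, k] in [Z], hence c ^ k in [A]; by [factor_conj_mem] k then lies in
   [A :&: K = 1]. *)
have fpf c : c \in A -> c \notin Z -> 'C_(K / Z)[coset Z c] = 1.
  move=> Ac nZc; apply/trivgP/subsetP=> y /setIP[/morphimP[k Nk Kk ->] /cent1P cyc].
  have : coset Z [~ c, k] = 1.
    by rewrite morphR ?(subsetP sAN c Ac) //=; apply/eqP/commgP/commute_sym.
  move/coset_idr=> h.
  have Zck : [~ c, k] \in Z by apply: h; rewrite groupR ?(subsetP sAN c Ac).
  apply/set1P/coset_id; apply: contraR nZc => nZk.
  have Gk := subsetP sKG k Kk.
  apply: (factor_conj_mem (g := k)) => //.
    by rewrite conjg_mulR groupM //; case/setIP: Zck.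
  apply: contra nZk => Ak; suff -> : k = 1 by rewrite group1.
  by apply/set1gP; rewrite -tiAK inE Ak.
have nKZ c : c \in A -> coset Z c \in 'N(K / Z).
  move=> Ac; rewrite inE.
  apply/subsetP=> _ /imsetP[_ /morphimP[k Nk Kk ->] ->].
  rewrite -morphJ ?(subsetP sAN c Ac) //=.
  have : k ^ c \in K * Z.
    by apply: KZconj; rewrite ?(subsetP sAG) //; apply/mulsgP; exists k 1; rewrite ?mulg1 ?group1.
  case/mulsgP=> k' z Kk' Zz ->.
  by rewrite mkerr ?(subsetP sKN k' Kk') ?ker_coset //= mem_morphim // (subsetP sKN k' Kk').
have inv c : c \in A -> c \notin Z -> c ^+ 2 \in Z ->
    {in K / Z, forall x, x ^ coset Z c = x^-1}.
  move=> Ac nZc c2; apply: involution_inverts (fpf _ Ac nZc); first exact: nKZ.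
  by rewrite -morphX ?(subsetP sAN c Ac) //= coset_id.
apply: contraR nnA => nZab.
have KZ1 : K / Z = 1.
  rewrite -(fpf _ (groupM Aa Ab) nZab); apply/esym/setIidPl/subsetP=> x Kx.
  apply/cent1P/commgP/conjg_fixP.
  by rewrite morphM ?(subsetP sAN a Aa) ?(subsetP sAN b Ab) //= conjgM inv // inv ?invgK ?groupV.
have sKZ : K \subset Z by rewrite -quotient_sub1 // KZ1.
have sKA : K \subset A by apply: subset_trans sKZ _; apply: subsetIl.
by rewrite -defG mul_subG ?normG // (subset_trans sKA) ?normG.
Qed.

End Factorization.

(** * Structure of non-DRR Cayley digraphs *)

Section RightRegular.
Local Open Scope group_scope.
Variable gT : finGroupType.
Implicit Types (S : {set gT}) (k p : {perm gT}) (g x y : gT).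

Let rho g : {perm gT} := actperm 'R g.

Let rhoE g x : rho g x = x * g. Proof. by rewrite actpermE. Qed.

Let mem_rho g : rho g \in right_regular gT.
Proof. by apply/morphimP; exists g; rewrite ?inE. Qed.

Let rhoP p : p \in right_regular gT -> exists g, p = rho g.
Proof. by case/morphimP=> g _ _ ->; exists g. Qed.

Let rhoM g h : rho (g * h) = rho g * rho h.
Proof. by apply/permP=> x; rewrite permM !rhoE mulgA. Qed.

Let rhoV g : rho g^-1 = (rho g)^-1.
Proof. by apply/permP=> x; apply: (perm_inj (s := rho g)); rewrite permKV !rhoE mulgKV. Qed.

(** Conjugating right translation by y gives right translation by some g, so k (u * y) = k u * g for
    all u; taking u = 1 identifies g as k y. *)
Lemma norm_right_regular_Aut k :
  k \in 'N(right_regular gT) -> k 1 = 1 -> k \in Aut [set: gT].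
Proof.
move=> nk k1; rewrite inE; apply/andP; split; first by apply/subsetP=> x; rewrite inE.
apply/morphicP=> x y _ _.
have /rhoP[g dg] : rho y ^ k \in right_regular gT by rewrite memJ_norm ?mem_rho.
have kE u : k (u * y) = k u * g.
  by rewrite -[k u * g]rhoE -dg conjgE !permM permK rhoE.
by rewrite kE -[in k y](mul1g y) kE k1 mul1g.
Qed.

Lemma diaut_cayley_mem S k x :
  k \in diaut (cayley S) -> k 1 = 1 -> (k x \in S) = (x \in S).
Proof.
by rewrite inE => /is_disoP/(_ x 1); rewrite !inE /= => + k1; rewrite k1 !invg1 !mulg1.
Qed.

Lemma DRR_diso S S' : diso (cayley S) (cayley S') -> DRR (cayley S) -> DRR (cayley S').
Proof.
move=> /existsP[p hp] /eqP dS; rewrite /DRR eq_sym eqEcard right_regular_sub /=.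
have -> : diaut (cayley S') = diaut (cayley S) :^ p.
  apply/setP=> q; rewrite mem_conjg !inE conjgE invgK.
  apply/idP/idP=> h.
    by rewrite mulgA; apply: is_disoM (is_disoM hp h) (is_disoV hp).
  have := is_disoM (is_disoM (is_disoV hp) h) hp.
  by rewrite !mulgA mulVg mul1g mulgKV.
by rewrite cardJg dS.
Qed.

(** A right translation corrects the isomorphism so that it fixes 1. It conjugates one automorphism
    group to the other, and both are [right_regular gT], so it normalises this group. *)
Lemma DRR_diso_Aut S S' : diso (cayley S) (cayley S') -> DRR (cayley S) ->
  exists2 a, a \in Aut [set: gT] & S' = a @: S.
Proof.
move=> iso dS; have dS' := DRR_diso iso dS.
case/existsP: iso => p hp.
have {hp} : is_diso (cayley S) (cayley S') (p * rho (p 1)^-1).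
  apply: is_disoM hp _; have := subsetP (right_regular_sub S') _ (mem_rho (p 1)^-1).
  by rewrite inE.
move: (p * _) (permM p (rho (p 1)^-1) 1); rewrite rhoE mulgV => {p}p p1 hp.
exists p.
  apply: norm_right_regular_Aut p1; rewrite inE; apply/subsetP=> q.
  rewrite mem_conjg => Rq; rewrite -(eqP dS'); move: Rq.
  rewrite -(eqP dS) !inE conjgE invgK => h.
  have := is_disoM (is_disoM (is_disoV hp) h) hp.
  by rewrite !mulgA mulVg mul1g mulgKV.
apply/setP=> x; apply/idP/imsetP=> [Sx|[y Sy ->]].
  exists (p^-1 x); rewrite ?permKV //.
  move/is_disoP/(_ (p^-1 x) 1): hp; rewrite permKV p1 !inE /= !invg1 !mulg1.
  by rewrite Sx => <-.
by move/is_disoP/(_ y 1): hp; rewrite p1 !inE /= !invg1 !mulg1 Sy.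
Qed.

Lemma non_DRR_structure S : abelian [set: gT] -> ~~ DRR (cayley S) ->
  (exists2 a, a \in Aut [set: gT] & a != 1 /\ forall x, (a x \in S) = (x \in S))
  \/
  (exists Z : {group gT}, [/\ Z \proper [set: gT],
     forall g, g \notin Z -> exists d, [/\ d \in Z, d != 1 & forall z, z \in Z ->
       (d * (g * z) \in S) = (g * z \in S) /\
       (d * (g^-1 * z) \in S) = (g^-1 * z \in S)]
   & forall a b, a \notin Z -> b \notin Z -> a ^+ 2 \in Z -> b ^+ 2 \in Z ->
       a * b \in Z]).
Proof.
move=> cTT nD; set R := right_regular gT.
have prR : R \proper diaut (cayley S).
  by rewrite properEneq right_regular_sub andbT eq_sym.
have [G /mingroupP[prG minG] sGD] := @mingroup_exists _ (fun H => R \proper H) _ prR.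
have mC x y : x * y = y * x by apply: (centsP cTT); rewrite inE.
have sRG := proper_sub prG.
pose K := 'C_G[1 | 'P]%G.
have memK k : (k \in K) = (k \in G) && (k 1 == 1).
  by rewrite inE; apply: andb_id2l => _; apply/astab1P/eqP.
have KS k x : k \in K -> (k x \in S) = (x \in S).
  rewrite memK => /andP[Gk /eqP k1]; apply: diaut_cayley_mem k1; exact: (subsetP sGD).
have defG : R * K = G.
  apply/eqP; rewrite eqEsubset mul_subG ?subsetIl //=.
  apply/subsetP=> p Gp; apply/mulsgP.
  exists (rho (p^-1 1)^-1) (rho (p^-1 1) * p); rewrite ?mem_rho //.
    by rewrite memK groupM ?(subsetP sRG _ (mem_rho _)) //= permM rhoE mul1g permKV.
  by rewrite rhoV mulKg.
have tiRK : R :&: K = 1.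
  apply/trivgP/subsetP=> p /setIP[/rhoP[g ->]]; rewrite memK rhoE mul1g.
  by case/andP=> _ /eqP ->; apply/set1gP/permP=> x; rewrite rhoE perm1 mulg1.
have cRR : abelian R by apply: morphim_abelian.
have maxR (H : {group {perm gT}}) : R \proper H -> H \subset G -> G \subset H.
  by move=> prH sHG; rewrite (minG H).
(* Point stabilisers in a transitive group are conjugate, so a normal subgroup inside [K] fixes
   every point. *)
have coreK (L : {group {perm gT}}) : L \subset K -> G \subset 'N(L) -> L :=: 1.
  move=> sLK nLG; apply/trivgP/subsetP=> l Ll; apply/set1gP/permP=> x.
  have : l ^ rho x^-1 \in K.
    by rewrite (subsetP sLK) // memJ_norm // (subsetP nLG) // (subsetP sRG) ?mem_rho.
  rewrite memK conjgE -rhoV invgK !permM !rhoE mul1g => /andP[_].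
  by rewrite -eq_mulgV1 perm1 => /eqP.
have [nRG | nRG] := boolP (G \subset 'N(R)).
  left; have [k Kk k1] : exists2 k, k \in K & k != 1.
    apply/exists_inP; apply: contraTT prG; rewrite negb_exists_in => /forall_inP K1.
    rewrite properE -defG mul_subG ?andbF //; apply/subsetP=> k /K1.
    by rewrite negbK => /eqP ->; apply: group1.
  exists k; last by split=> // x; apply: KS.
  move: (Kk); rewrite memK => /andP[Gk /eqP]; apply: norm_right_regular_Aut.
  exact: (subsetP nRG).
right; pose Z := (R :&: 'Z(G))%G.
have Zproper : Z \proper R := factor_center_proper nRG.
have Ztwist := factor_twist defG tiRK cRR maxR nRG coreK.
have Zinv := factor_involution defG tiRK cRR maxR nRG.
exists (actperm 'R @*^-1 Z)%G.
have memZ g : (g \in actperm 'R @*^-1 Z) = (rho g \in Z) by rewrite /morphpre in_setI in_setT inE.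
have Zcomm x k u : x \in actperm 'R @*^-1 Z -> k \in K -> k (u * x) = k u * x.
  rewrite memZ memK => /setIP[_ /centerP[_ cx]] /andP[Gk _].
  by rewrite -[u * x]rhoE -permM cx // permM rhoE.
split.
- rewrite properT; apply: contraL Zproper => /eqP ZT.
  rewrite properE negb_and negbK orbC; apply/orP; left; apply/subsetP=> p /rhoP[g ->].
  by rewrite -memZ ZT inE.
- move=> g; rewrite memZ => /(Ztwist _ (mem_rho g))[k [k' [z [Kk Kk' Zz [z1 def]]]]].
  have /rhoP[d dz] : z \in R by case/setIP: Zz.
  have Zd : d \in actperm 'R @*^-1 Z by rewrite memZ -dz.
  (* Evaluating [def] at 1 gives k g = d * g, and at g^-1 it gives k' g^-1 = d^-1 * g^-1. Since [K]
     commutes with translations from [Z], k and k' act on the two cosets as d and d^-1. *)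
  have kg : k g = d * g.
    move/permP/(_ 1): def; rewrite dz conjgE invgK !permM -rhoV !rhoE mul1g.
    move: Kk'; rewrite memK => /andP[_ /eqP->]; rewrite mul1g => <-.
    by rewrite mulgKV.
  have kg' : k' g^-1 = d^-1 * g^-1.
    have -> : k' = k ^ (rho g)^-1 * (rho d)^-1 by rewrite def dz mulgK.
    rewrite conjgE invgK !permM -!rhoV !rhoE mulVg.
    by move: Kk; rewrite memK => /andP[_ /eqP->]; rewrite mul1g mC.
  exists d; split=> //.
    by apply: contraNneq z1 => d1; rewrite dz d1; apply/eqP/permP=> x; rewrite rhoE perm1 mulg1.
  move=> x Zx; split; first by rewrite mulgA -kg -Zcomm // KS.
  rewrite -(KS k' (d * _)) //.
  have -> : d * (g^-1 * x) = g^-1 * (d * x) by rewrite !mulgA (mC d g^-1).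
  by rewrite (Zcomm (d * x) k') ?groupM // kg' (mC d^-1) -mulgA mulKg.
- move=> a b; rewrite !memZ => nZa nZb; rewrite expg2 rhoM -expg2 => a2.
  rewrite expg2 rhoM -expg2 => b2; rewrite rhoM; exact: Zinv.
Qed.
End RightRegular.

(** * Counting *)

Section Counting.
Local Open Scope nat_scope.

Definition invariant_subsets (T : finType) (s : {perm T}) (V : {set T}) : {set {set T}} :=
  [set S in powerset V | [forall x, (s x \in S) == (x \in S)]].

(** An invariant subset is a union of cycles of [s] contained in [V]. Counting fixed points twice
    gives every cycle weight at least 2; squaring avoids halving the exponent. *)
Lemma card_invariant_subsets (T : finType) (s : {perm T}) (V : {set T}) :
  #|invariant_subsets s V| ^ 2 <= 2 ^ (#|V| + #|[set x in V | s x == x]|).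
Proof.
pose P := [set O in porbits s | O \subset V].
have inv S x y : S \in invariant_subsets s V -> x \in S -> y \in porbit s x -> y \in S.
  rewrite inE => /andP[_ /forallP invS] Sx /porbitP[i ->].
  by elim: i => [|i IH]; rewrite ?expg0 ?perm1 // expgSr permM (eqP (invS _)).
have le1 : #|invariant_subsets s V| <= 2 ^ #|P|.
  rewrite -card_powerset -(card_in_imset (f := fun S : {set T} => [set porbit s x | x in S])).
    apply: subset_leq_card; apply/subsetP=> _ /imsetP[S IS ->].
    rewrite inE; apply/subsetP=> _ /imsetP[x Sx ->]; rewrite inE imset_f //=.
    apply/subsetP=> y /(inv _ _ _ IS Sx); apply/subsetP.
    by move: IS; rewrite !inE => /andP[].
  move=> S S' IS IS' eqS; apply/setP=> x; apply/idP/idP=> Sx.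
    have /imsetP[y Sy /eqP] : porbit s x \in [set porbit s z | z in S'] by rewrite -eqS imset_f.
    by rewrite eq_porbit_mem => /(inv _ _ _ IS' Sy).
  have /imsetP[y Sy /eqP] : porbit s x \in [set porbit s z | z in S] by rewrite eqS imset_f.
  by rewrite eq_porbit_mem => /(inv _ _ _ IS Sy).
have le2 : #|P| * 2 <= #|V| + #|[set x in V | s x == x]|.
  have tiP : trivIset P.
    apply/trivIsetP=> O O'; rewrite !inE => /andP[/imsetP[x _ ->] _] /andP[/imsetP[y _ ->] _].
    apply: contraR => /pred0Pn[z /andP[/= xz yz]].
    apply/eqP; transitivity (porbit s z); apply/eqP; first by rewrite eq_sym eq_porbit_mem.
    by rewrite eq_porbit_mem.
  have -> : #|V| + #|[set x in V | s x == x]| = \sum_(x in V) (1 + (s x == x)).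
    by rewrite big_split /= sum1_card -sum1dep_card big_mkcondr.
  have sPV : cover P \subset V by apply/bigcupsP=> O; rewrite inE => /andP[].
  rewrite (big_setID (cover P)) /= (setIidPr sPV) (leq_trans _ (leq_addr _ _)) //.
  rewrite big_trivIset //= -sum_nat_const; apply: leq_sum => O.
  rewrite inE => /andP[/imsetP[x _ ->] _].
  rewrite (bigD1 x) ?porbit_id //=; case: eqP => [//|sx].
  rewrite (bigD1 (s x)) /=; first by rewrite addn0 -addnA.
  by rewrite -{1}(expg1 s) mem_porbit; apply/eqP.
by rewrite (leq_trans (_ : _ <= (2 ^ #|P|) ^ 2)) ?leq_exp2r // -expnM leq_exp2l.
Qed.

(** The sum is at most [#|P|] times its largest term. The positive exponent makes the bound hold for
    the empty maximum 0. *)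
Lemma sum_expn_le (I : finType) (P : {pred I}) (F : I -> nat) k C :
  (forall i, i \in P -> F i ^ k.+1 <= C) ->
  (\sum_(i in P) F i) ^ k.+1 <= #|P| ^ k.+1 * C.
Proof.
move=> leC; apply: (@leq_trans ((#|P| * \max_(i in P) F i) ^ k.+1)).
  by rewrite leq_exp2r // -sum_nat_const; apply: leq_sum => i Pi; apply: leq_bigmax_cond.
rewrite expnMn leq_mul2l; apply/orP; right.
apply: (big_ind (fun m => m ^ k.+1 <= C)) => // [|x y]; first by rewrite exp0n.
by rewrite /maxn; case: ifP.
Qed.

(** * Generating tuples, and the number of subgroups and automorphisms *)

Section Generators.
Variable gT : finGroupType.

(** Each generator added outside the span so far at least doubles the order, so at most [k] are
    used; the tuple is padded with 1. *)
Lemma gen_tuple (G : {group gT}) k : #|G| < 2 ^ k.+1 ->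
  exists t : k.-tuple gT, <<[set x in t]>>%g = G.
Proof.
move=> ltGk.
suff [s le_s defG] : exists2 s : seq gT, 2 ^ size s <= #|G| & <<[set x in s]>>%g = G.
  have le_sk : size s <= k by rewrite -ltnS -(ltn_exp2l _ _ (ltnSn 1)) (leq_ltn_trans le_s).
  have sz : size (s ++ nseq (k - size s) 1%g) == k by rewrite size_cat size_nseq subnKC.
  exists (Tuple sz); apply/eqP; rewrite eqEsubset -{2}defG !gen_subG; apply/andP; split.
    apply/subsetP=> x; rewrite inE mem_cat mem_nseq => /orP[sx|/andP[_ /eqP->]] //.
    by rewrite -defG mem_gen // inE.
  by apply/subsetP=> x; rewrite inE => sx; rewrite mem_gen // inE mem_cat sx.
suff ext m (s : seq gT) : #|G| - #|<<[set x in s]>>%g| <= m ->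
    (<<[set x in s]>> \subset G)%g -> 2 ^ size s <= #|<<[set x in s]>>%g| ->
    exists2 s : seq gT, 2 ^ size s <= #|G| & <<[set x in s]>>%g = G.
  by apply: (ext _ [::] (leqnn _)); rewrite ?gen_subG ?cardG_gt0 //; apply/subsetP=> x; rewrite inE.
elim: m s => [|m IH] s lem sG le_s.
  have eqG : <<[set x in s]>>%g = G.
    by apply/eqP; rewrite eqEcard sG -subn_eq0 -leqn0.
  by exists s => //; rewrite -eqG.
have [sG'|/subsetPn[x Gx nsx]] := boolP (G \subset <<[set x in s]>>%g).
  have eqG : <<[set x in s]>>%g = G by apply/eqP; rewrite eqEsubset sG.
  by exists s => //; rewrite -eqG.
have sub : (<<[set x in s]>> \subset <<[set y in x :: s]>>)%g.
  by apply: genS; apply/subsetP=> y; rewrite !inE => ->; rewrite orbT.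
have lt : #|<<[set x in s]>>%g| * 2 <= #|<<[set y in x :: s]>>%g|.
  rewrite -(Lagrange sub) leq_mul2l indexg_gt1 orbC; apply/orP; left.
  by apply: contra nsx => /subsetP; apply; rewrite mem_gen // !inE eqxx.
apply: (IH (x :: s)).
- rewrite leq_subLR (leq_trans _ (leq_add (leqnn _) (_ : m <= m))) //.
  move: lem; rewrite leq_subLR => /leq_trans; apply; rewrite addnS -addSn leq_add2r.
  by apply: leq_trans lt; rewrite muln2 -addnn -addn1 leq_add2l cardG_gt0.
- rewrite gen_subG; apply/subsetP=> y; rewrite !inE => /orP[/eqP->//|sy].
  by apply: (subsetP sG); rewrite mem_gen // inE.
by apply: leq_trans lt; rewrite /= expnS mulnC leq_mul2r le_s orbT.
Qed.

(** A proper subgroup has at most half the order, so it needs one generator fewer. The factor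
    [#|gT|] saved here pays for the one in [card_twisted_subsets]. *)
Lemma card_proper_subgroups k : #|gT| < 2 ^ k.+2 ->
  #|[set Z : {group gT} | Z \proper [set: gT]]| <= #|gT| ^ k.
Proof.
move=> lt_k; rewrite -card_tuple -cardsT.
apply: leq_trans (leq_imset_card (fun t : k.-tuple gT => <<[set x in t]>>%G) _).
apply: subset_leq_card; apply/subsetP=> Z; rewrite inE => prZ.
have [|t defZ] := @gen_tuple Z k.
  rewrite -(ltn_pmul2r (ltn0Sn 1)) -expnSr; apply: leq_ltn_trans lt_k.
  rewrite -cardsT -(Lagrange (proper_sub prZ)) leq_mul2l indexg_gt1 orbC.
  by case/andP: prZ => _ ->.
by apply/imsetP; exists t => //; apply/val_inj.
Qed.

Lemma Aut_equalizer_group_set (a b : {perm gT}) :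
  a \in Aut [set: gT] -> b \in Aut [set: gT] -> group_set [set x | a x == b x].
Proof.
move=> aA bA; have [ma mb] := (morphicP (Aut_morphic aA), morphicP (Aut_morphic bA)).
apply/group_setP; split=> [|x y]; last first.
  by rewrite !inE ma ?inE // mb ?inE // => /eqP-> /eqP->.
have fix1 (c : {perm gT}) : {in [set: gT] &, {morph c : x y / (x * y)%g}} -> c 1%g = 1%g.
  by move=> mc; apply: (mulgI (c 1%g)); rewrite -mc ?inE // !mulg1.
by rewrite inE !fix1.
Qed.

Lemma card_Aut_setT k : #|gT| < 2 ^ k.+1 -> #|Aut [set: gT]| <= #|gT| ^ k.
Proof.
move=> lt_k; have [|t defG] := @gen_tuple [set: gT]%G k; first by rewrite cardsT.
rewrite -card_tuple -(card_in_imset (f := fun a : {perm gT} => [tuple of map a t])).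
  exact: max_card.
move=> a b aA bA /(congr1 val) /= eqab; apply/permP=> x.
pose E := Group (Aut_equalizer_group_set aA bA).
have : [set: gT]%G \subset E.
  rewrite -defG gen_subG; apply/subsetP=> y; rewrite !inE => ty.
  by apply/eqP; apply/eq_in_map: y ty.
by move/subsetP/(_ x); rewrite !inE => /(_ isT)/eqP.
Qed.
End Generators.
End Counting.

Lemma card_bigcup_le (I T : finType) (P : {pred I}) (F : I -> {set T}) :
  (#|\bigcup_(i in P) F i| <= \sum_(i in P) #|F i|)%N.
Proof.
elim/big_rec2: _ => [|i m U _ leU]; first by rewrite cards0.
by apply: leq_trans (leq_card_setU _ _) _; rewrite leq_add2l.
Qed.

(** * Invariant and twisted subsets of the complement of an index-two subgroup *)

Section IndexTwo.
Local Open Scope group_scope.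
Local Open Scope nat_scope.
Variables (gT : finGroupType) (B : {group gT}).
Hypotheses (cTT : abelian [set: gT]) (iB : #|[set: gT] : B|%g = 2).

Local Notation V := (~: B).

Let mC (x y : gT) : (x * y = y * x)%g.
Proof. by apply: (centsP cTT); rewrite inE. Qed.

Lemma card_index2 : #|B| = #|V|.
Proof.
apply/eqP; rewrite -(eqn_add2l #|B|) [X in _ == X]cardsC -cardsT.
by rewrite -(Lagrange (subsetT B)) iB muln2 addnn.
Qed.

Lemma card_setC_index2 : #|gT| = 2 * #|V|.
Proof. by rewrite -cardsT -(Lagrange (subsetT B)) iB card_index2 mulnC. Qed.

Let notinM x y : x \notin B -> y \notin B -> (x * y)%g \in B.
Proof.
move=> nx ny; have /eqP defV : x *: B == V.
  rewrite eqEcard card_lcoset; apply/andP; split.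
    by apply/subsetP=> _ /lcosetP[b Bb ->]; rewrite inE groupMr.
  by rewrite card_index2.
have : y^-1 \in x *: B by rewrite defV inE groupV.
by rewrite mem_lcoset -groupV invMg !invgK mC.
Qed.

Lemma card_setD_index2 (H : {group gT}) : #|H :\: B| <= #|H :&: B|.
Proof.
have [->|[h /setDP[Hh nBh]]] := set_0Vmem (H :\: B); first by rewrite cards0.
rewrite -(card_imset _ (mulgI h)); apply: subset_leq_card.
apply/subsetP=> _ /imsetP[x /setDP[Hx nBx] ->].
by rewrite inE groupM //= notinM.
Qed.

(** The fixed points of [a] form a proper subgroup, of order at most [#|V|], and at most half of
    them lie outside [B]. *)
Lemma card_Aut_invariant (a : {perm gT}) : a \in Aut [set: gT] -> a != 1%g ->
  #|invariant_subsets a V| ^ 4 <= 2 ^ (3 * #|V|).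
Proof.
move=> aA a1; pose F := Group (Aut_equalizer_group_set aA (group1 (Aut_group [set: gT]))).
have memF x : (x \in F) = (a x == x) by rewrite inE perm1.
have prF : F \proper [set: gT].
  rewrite properT; apply: contraNneq a1 => FT; apply/eqP/permP=> x.
  by apply/eqP; rewrite perm1 -memF FT inE.
have leF : 2 * #|[set x in V | a x == x]| <= #|V|.
  have -> : [set x in V | a x == x] = F :\: B.
    by apply/setP=> x; rewrite !inE perm1.
  have leFV : #|F| <= #|V|.
    rewrite -(leq_pmul2l (ltn0Sn 1)) -card_setC_index2 -cardsT -(Lagrange (proper_sub prF)) mulnC.
    by rewrite leq_mul2l indexg_gt1 orbC; case/andP: prF => _ ->.
  apply: leq_trans leFV; rewrite -(cardsID B F) mul2n -addnn leq_add2r.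
  exact: card_setD_index2.
have h := card_invariant_subsets a V.
rewrite (expnM _ 2 2); apply: leq_trans (_ : (2 ^ (#|V| + #|[set x in V | a x == x]|)) ^ 2 <= _).
  by rewrite leq_exp2r.
by rewrite -expnM leq_exp2l //; lia.
Qed.

(** An orbit of inversion on the cosets of [Z]; since the group is abelian, the blocks partition
    it. *)
Definition twist_block (Z : {group gT}) g : {set gT} := g *: Z :|: g^-1 *: Z.

Definition twisted_subsets (Z : {group gT}) (U : {set gT}) : {set {set gT}} :=
  [set S in powerset U | [forall g, (g \notin Z) ==> [exists d in Z,
     (d != 1%g) && [forall x in twist_block Z g, (d * x \in S)%g == (x \in S)]]]].

Section TwistedSubsets.
Variable Z : {group gT}.
Hypothesis prZ : Z \proper [set: gT].
Hypothesis invZ : forall a b : gT, a \notin Z -> b \notin Z ->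
  (a ^+ 2)%g \in Z -> (b ^+ 2)%g \in Z -> (a * b)%g \in Z.

Let O := twist_block Z.

Let mem_O x g : (x \in O g) = (g^-1 * x \in Z)%g || (g * x \in Z)%g.
Proof. by rewrite inE !mem_lcoset invgK. Qed.

Let O_id g : g \in O g. Proof. by rewrite mem_O mulVg group1. Qed.

Let O_eq x g : x \in O g -> O x = O g.
Proof.
have lc a b : (a^-1 * b)%g \in Z -> b *: Z = a *: Z.
  by move=> h; apply/lcoset_eqP; rewrite mem_lcoset.
rewrite mem_O => /orP[h|h]; rewrite /O /twist_block.
  by rewrite (lc _ _ h) (lc g^-1 x^-1)%g // invgK -groupV invMg invgK mC.
by rewrite setUC (lc g x^-1)%g ?(lc g^-1 x)%g ?invgK // -invMg groupV mC.
Qed.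

Let O_mull d x : d \in Z -> O (d * x)%g = O x.
Proof. by move=> Zd; apply: O_eq; rewrite mem_O (mC d) mulKg Zd. Qed.

Let Om := [set O g | g in V :\: Z].

Let c := #|Z :&: B|.

(* If the translation [d] preserving [S] on a block lies outside [B], then [S]
   misses that block, so any element of [Z :&: B] preserves it as well. *)
Let W : {set gT} := (if Z :&: B == 1%g then Z^# else (Z :&: B)^#)%g.

Let subWZ : W \subset Z.
Proof.
rewrite /W; case: ifP => _; first exact: subsetDl.
by apply: subset_trans (subsetDl _ _) (subsetIl _ _).
Qed.

Let notW1 : 1%g \notin W.
Proof. by rewrite /W; case: ifP => _; rewrite !inE eqxx. Qed.

Let cardW : #|W| <= #|gT|. Proof. exact: max_card. Qed.

Let e := #|Z :\: B|.

Let le_ec : e <= c. Proof. exact: card_setD_index2. Qed.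

Let cardZ : #|Z| = c + e. Proof. by rewrite cardsID. Qed.

(** If [Z :&: B] is trivial, then [Z] has order at most 2 and [W] at most one element. Otherwise
    this is (c - 1)^2 <= 2^c. *)
Let cardW2 : #|W| ^ 2 <= 2 ^ c.
Proof.
rewrite /W; have [Y1|_] := eqVneq (Z :&: B) 1%g.
  have c1 : c = 1 by rewrite /c Y1 cards1.
  have defm : c + e = 1 + #|Z^#%g| by rewrite -cardZ (cardsD1 1%g Z) group1.
  have m1 : #|Z^#%g| <= 1 by move: le_ec; lia.
  by rewrite c1; apply: leq_trans (_ : 1 ^ 2 <= _) => //; rewrite leq_exp2r.
have := cardsD1 1%g (Z :&: B); rewrite !inE !group1 -/c => ->.
rewrite add1n; move: #|_| => m.
elim: m => [|[|[|m]] IH] //; move: IH; rewrite !expnS !expn0; lia.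
Qed.

(* Every block meets [V :\: Z] in at least [2 * c] points, except for the
   single possible block [g *: Z] with [g ^+ 2 \in Z]. *)
Let Om_card : 2 * c * #|Om| <= #|V :\: Z| + c.
Proof.
pose I := [set O g | g in [set g in V :\: Z | (g ^+ 2)%g \in Z]].
have cardI : #|I| <= 1.
  apply/card_le1P=> _ /imsetP[g Ig ->] E; rewrite inE.
  apply/imsetP/eqP=> [[h Ih ->]|->]; last by exists g.
  move: Ig Ih; rewrite !inE => /andP[/andP[nZg _] g2] /andP[/andP[nZh _] h2].
  by apply: O_eq; rewrite mem_O (invZ nZg nZh) ?orbT.
have block g : g \in V :\: Z ->
    2 * c <= #|[set x in V :\: Z | O x == O g]| + c * (O g \in I).
  move=> Ug; have [nZg nBg] : g \notin Z /\ g \notin B by move: Ug; rewrite !inE => /andP[].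
  have sub h : h \in O g -> h \notin Z -> h \notin B ->
      h *: (Z :&: B) \subset [set x in V :\: Z | O x == O g].
    move=> Oh nZh nBh; apply/subsetP=> _ /lcosetP[z /setIP[Zz Bz] ->].
    by rewrite !inE !groupMr // nZh nBh mC O_mull //; apply/eqP/O_eq.
  have cardl h : #|h *: (Z :&: B)| = c by rewrite card_lcoset.
  have sub1 := sub g (O_id g) nZg nBg.
  have sub2 : g^-1 *: (Z :&: B) \subset [set x in V :\: Z | O x == O g].
    by apply: sub; rewrite ?groupV // mem_O mulgV group1 orbT.
  have [Ig|nIg] := boolP (O g \in I).
    by rewrite muln1 mul2n -addnn leq_add2r -(cardl g) subset_leq_card.
  rewrite muln0 addn0 mul2n -addnn -{1}(cardl g) -(cardl g^-1%g) -cardsUI.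
  have -> : (g *: (Z :&: B)) :&: (g^-1 *: (Z :&: B)) = set0.
    (* A common point of the two cosets forces g ^+ 2 into [Z], that is, the exceptional block. *)
    apply/eqP/set0Pn=> -[x]; rewrite !inE !mem_lcoset !inE invgK.
    case/andP=> /andP[Z1 _] /andP[Z2 _]; case/negP: nIg; apply: imset_f.
    by rewrite inE Ug /= -(groupMr _ Z1) expg2 -mulgA mulKVg Z2.
  by rewrite cards0 addn0 subset_leq_card // subUset sub1.
have -> : #|V :\: Z| = \sum_(E in Om) #|[set x in V :\: Z | O x == E]|.
  rewrite -sum1_card (partition_big_imset O) /=; apply: eq_bigr => E _.
  by rewrite -sum1dep_card.
rewrite mulnC -sum_nat_const (@leq_trans (\sum_(E in Om)
    (#|[set x in V :\: Z | O x == E]| + c * (E \in I)))) //.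
  by apply: leq_sum => _ /imsetP[g Ug ->]; apply: block.
rewrite big_split leq_add2l -big_distrr /= -[leqRHS]muln1 leq_mul2l; apply/orP; right.
apply: leq_trans cardI; rewrite -sum1_card (big_mkcond (mem I)) /=.
rewrite big_mkcond; apply: leq_sum => E _.
by case: (E \in Om); case: (E \in I).
Qed.

Let Om_gt0 : 0 < #|Om|.
Proof.
have [V0|[g Vg]] := set_0Vmem (V :\: Z); last by apply/card_gt0P; exists (O g); apply: imset_f.
have sVZ : V \subset Z by rewrite -setD_eq0 V0.
have : V = Z :> {set gT}.
  apply/eqP; rewrite eqEcard sVZ /= -(leq_pmul2l (ltn0Sn 1)) -card_setC_index2 -cardsT.
  rewrite -(Lagrange (proper_sub prZ)) mulnC leq_mul2l indexg_gt1 orbC.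
  by case/andP: prZ => _ ->.
by move/setP/(_ 1%g); rewrite !inE !group1.
Qed.

(* The default 1 is taken only when the map is not bijective, which does not
   happen for [f] with values in [Z]. *)
Let sig (f : {ffun {set gT} -> gT}) : {perm gT} :=
  odflt 1%g [pick s : {perm gT} | [forall x, s x == (f (O x) * x)%g]].

Let sigE f : f \in pffun_on 1%g (mem Om) (mem W) -> forall x, sig f x = (f (O x) * x)%g.
Proof.
move=> /pffun_onP[/subsetP suppf fW].
have fZ E : f E \in Z.
  have [->|fE] := eqVneq (f E) 1%g; first exact: group1.
  apply: (subsetP subWZ); apply: fW; apply/imageP; exists E => //; exact: suppf.
have inj : injective (fun x => f (O x) * x)%g.
  move=> x y /= eqxy; have eqO : O x = O y.
    by rewrite -(O_mull x (fZ (O x))) eqxy O_mull.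
  by move: eqxy; rewrite eqO => /mulgI.
rewrite /sig; case: pickP => [s /forallP/= sP x|/(_ (perm inj))/forallP[] x].
  by apply/eqP.
by rewrite permE.
Qed.

Let sig_fixed f : f \in pffun_on 1%g (mem Om) (mem W) ->
  #|[set x in V | sig f x == x]| <= #|Z :\: B|.
Proof.
move=> Ff; apply: subset_leq_card; apply/subsetP=> x.
rewrite in_set sigE // => /andP[Vx fx]; rewrite in_setD.
have -> /= : x \notin B by rewrite inE in Vx.
apply: contraR notW1 => nZx; case/pffun_onP: Ff => _ /(_ 1%g); apply.
apply/imageP; exists (O x); first by rewrite imset_f // inE nZx.
by apply: (mulIg x); rewrite (eqP fx) mul1g.
Qed.

Let twisted_inv S : S \in twisted_subsets Z V ->
  exists2 f, f \in pffun_on 1%g (mem Om) (mem W) & S \in invariant_subsets (sig f) V.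
Proof.
rewrite inE => /andP[sSV twS].
have wP g : g \in V :\: Z -> exists2 w, w \in W & forall x, x \in O g -> (w * x \in S)%g = (x \in S).
  rewrite inE => /andP[nZg Vg]; have /implyP/(_ nZg)/exists_inP[d Zd /andP[d1 /forall_inP dP]] := forallP twS g.
  have [Bd|nBd] := boolP (d \in B).
    exists d => [|x /dP/eqP //]; rewrite /W.
    by case: ifP => _; rewrite !inE d1 Zd ?Bd.
  rewrite /W; have [Y1|] := eqVneq (Z :&: B) 1%g.
    by exists d => [|x /dP/eqP //]; rewrite !inE d1.
  case/trivgPn=> w /setIP[Zw Bw] w1; exists w; first by rewrite !inE w1 Zw.
  move=> x Ox.
  have none y : y \in O g -> y \notin S.
    move=> Oy; apply/negP=> Sy; have Sdy : (d * y)%g \in S by rewrite (eqP (dP _ Oy)).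
    have sV := subsetP (_ : S \subset V); rewrite powersetE in sSV.
    by have := sV sSV _ Sdy; rewrite inE notinM //; have := sV sSV _ Sy; rewrite inE.
  rewrite (negPf (none _ Ox)) (negPf (none _ _)) //.
  by rewrite -(O_eq Ox) -(O_mull x Zw) O_id.
(* On [Om] the default of [odflt] is never reached, by [wP]; off [Om] the value 1 makes [sig f] fix
   the block pointwise. *)
pose f := [ffun E : {set gT} => if E \in Om then
  odflt 1%g [pick w in W | [forall x in E, (w * x \in S)%g == (x \in S)]] else 1%g].
have fP E : E \in Om -> f E \in W /\ forall x, x \in E -> (f E * x \in S)%g = (x \in S).
  move=> OmE; rewrite ffunE OmE; case: pickP => [w /andP[Ww /forall_inP h]|none] /=.
    by split=> // x /h/eqP.
  case/imsetP: OmE none => g Vg -> /=; have [w Ww h] := wP g Vg.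
  by move/(_ w); rewrite Ww /= => /forall_inP[] x /h->.
have Ff : f \in pffun_on 1%g (mem Om) (mem W).
  apply/pffun_onP; split.
    by apply/subsetP=> E; rewrite inE ffunE; case: ifP => //; rewrite eqxx.
  by move=> _ /imageP[E OmE ->]; case: (fP E OmE).
exists f => //; rewrite inE sSV; apply/forallP=> x; rewrite sigE //.
have [OmO|nOm] := boolP (O x \in Om); first by rewrite (fP _ OmO).2 ?O_id.
by rewrite ffunE (negPf nOm) mul1g.
Qed.

(** There are [#|W| ^ #|Om|] functions choosing a translation on each block, and each resulting
    permutation fixes at most [e] points of [V]. *)
Lemma card_twisted_subsets : #|twisted_subsets Z V| ^ 4 <= #|gT| ^ 4 * 2 ^ (3 * #|V|).
Proof.
have le1 : #|twisted_subsets Z V| <=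
    \sum_(f in pffun_on 1%g (mem Om) (mem W)) #|invariant_subsets (sig f) V|.
  apply: (@leq_trans #|\bigcup_(f in pffun_on 1%g (mem Om) (mem W)) invariant_subsets (sig f) V|).
    apply: subset_leq_card; apply/subsetP=> S /twisted_inv[f Ff Sf].
    by apply/bigcupP; exists f.
  exact: card_bigcup_le.
have le2 : #|twisted_subsets Z V| ^ 2 <= (#|W| ^ #|Om|) ^ 2 * 2 ^ (#|V| + e).
  apply: (@leq_trans ((\sum_(f in pffun_on 1%g (mem Om) (mem W)) #|invariant_subsets (sig f) V|) ^ 2)).
    by rewrite leq_exp2r.
  rewrite -(card_pffun_on 1%g (mem Om) (mem W)); apply: sum_expn_le => f Ff.
  apply: leq_trans (card_invariant_subsets _ _) _.
  by rewrite leq_exp2l // leq_add2l sig_fixed.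
rewrite (expnM _ 2 2); apply: leq_trans (_ : _ <= ((#|W| ^ #|Om|) ^ 2 * 2 ^ (#|V| + e)) ^ 2) _.
  by rewrite leq_exp2r.
have cardVZ : #|V| = #|V :\: Z| + e.
  rewrite addnC -(cardsID Z V); congr (_ + _); apply: eq_card => x.
  by rewrite !inE andbC.
move: Om_card Om_gt0 le_ec; case: #|Om| => // k; rewrite -mulnA mulnS => le_k _ le_ec'.
(* One block is paid for by [#|gT| ^ 4], the other k by [cardW2]. The remaining exponent 2ck + 2(|V|
   + e) is at most 3|V|, because 2ck + c + e <= |V| and e <= c. *)
rewrite expnMn -!expnM; apply: (@leq_trans (#|W| ^ 4 * (2 ^ (c * (2 * k)) * 2 ^ ((#|V| + e) * 2)))).
  rewrite [leqRHS]mulnA leq_mul2r; apply/orP; right.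
  have -> : k.+1 * (2 * 2) = 4 + 2 * (2 * k) by lia.
  rewrite expnD leq_mul2l expnM (expnM 2 c); apply/orP; right.
  by case: (2 * k) => // j; rewrite leq_exp2r.
apply: leq_mul; first by rewrite leq_exp2r.
by rewrite -expnD leq_exp2l //; lia.
Qed.
End TwistedSubsets.
End IndexTwo.

(** * Isomorphism classes *)

Section Classes.
Local Open Scope group_scope.
Local Open Scope nat_scope.
Variables (gT : finGroupType) (B : {group gT}).

Definition non_DRR_sets : {set {set gT}} :=
  [set S in powerset (~: B) | ~~ DRR (cayley S)].

(** Each alternative of [non_DRR_structure] accounts for at most the fourth root of [C] sets; 16 = 2
    ^ 4 comes from adding the two. *)
Lemma card_non_DRR_sets k : abelian [set: gT] -> #|[set: gT] : B|%g = 2 ->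
  #|gT| < 2 ^ k.+1 ->
  #|non_DRR_sets| ^ 4 <= 16 * (#|gT| ^ k) ^ 4 * 2 ^ (3 * #|~: B|).
Proof.
move=> cTT iB lt_k; set C := (#|gT| ^ k) ^ 4 * 2 ^ (3 * #|~: B|).
pose As := [set a in Aut [set: gT] | a != 1%g].
pose Zs := [set Z : {group gT} | (Z \proper [set: gT]) && [forall a, forall b,
  [&& a \notin Z, b \notin Z, (a ^+ 2)%g \in Z & (b ^+ 2)%g \in Z] ==> ((a * b)%g \in Z)]].
pose X1 := \bigcup_(a in As) invariant_subsets a (~: B).
pose X2 := \bigcup_(Z in Zs) twisted_subsets Z (~: B).
have sX : non_DRR_sets \subset X1 :|: X2.
  apply/subsetP=> S /setIdP[sS nD]; rewrite in_setU.
  case: (non_DRR_structure cTT nD) => [[a aA [a1 aS]]|[Z [prZ twZ invZ]]]; apply/orP.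
    left; apply/bigcupP; exists a; first by rewrite inE aA.
    by rewrite inE sS; apply/forallP=> x; apply/eqP.
  right; apply/bigcupP; exists Z.
    rewrite inE prZ; apply/'forall_forallP=> a b; apply/implyP=> /and4P[]; exact: invZ.
  rewrite inE sS; apply/forallP=> g; apply/implyP=> /twZ[d [Zd d1 dS]].
  apply/exists_inP; exists d => //; rewrite d1; apply/forall_inP=> x.
  by case/setUP=> /lcosetP[z Zz ->]; case: (dS z Zz) => h1 h2; apply/eqP.
have le1 : #|X1| ^ 4 <= C.
  apply: leq_trans (_ : #|As| ^ 4 * 2 ^ (3 * #|~: B|) <= _).
    apply: leq_trans (_ : (\sum_(a in As) #|invariant_subsets a (~: B)|) ^ 4 <= _).
      by rewrite leq_exp2r // card_bigcup_le.
    by apply: sum_expn_le => a /setIdP[aA a1]; apply: card_Aut_invariant.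
  rewrite leq_mul2r leq_exp2r //; apply/orP; right.
  by apply: leq_trans (card_Aut_setT lt_k); apply/subset_leq_card/subsetP=> a /setIdP[].
have le2 : #|X2| ^ 4 <= C.
  (* The order is even, so [k] is positive, as [card_proper_subgroups] requires after the shift. *)
  case: k lt_k @C le1 => [|k] lt_k C _.
    have : 2 %| #|gT| by rewrite -iB -cardsT dvdn_indexg.
    by move: lt_k; rewrite expn1; have := cardG_gt0 [set: gT]%G; rewrite cardsT; case: #|gT| => [|[]].
  apply: leq_trans (_ : #|Zs| ^ 4 * (#|gT| ^ 4 * 2 ^ (3 * #|~: B|)) <= _).
    apply: leq_trans (_ : (\sum_(Z in Zs) #|twisted_subsets Z (~: B)|) ^ 4 <= _).
      by rewrite leq_exp2r // card_bigcup_le.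
    apply: sum_expn_le => Z; rewrite inE => /andP[prZ /'forall_forallP invZ].
    apply: card_twisted_subsets => // a b nZa nZb a2 b2.
    by apply: (implyP (invZ a b)); apply/and4P.
  rewrite mulnA -expnMn leq_mul2r leq_exp2r // expnSr leq_mul2r; apply/orP; right.
  apply/orP; right; apply: leq_trans (card_proper_subgroups lt_k).
  by apply/subset_leq_card/subsetP=> Z; rewrite !inE => /andP[].
have leX : #|non_DRR_sets| <= 2 * maxn #|X1| #|X2|.
  apply: leq_trans (subset_leq_card sX) _; apply: leq_trans (leq_card_setU _ _) _.
  by rewrite mul2n -addnn leq_add ?leq_maxl ?leq_maxr.
rewrite -mulnA -/C; apply: leq_trans (_ : (2 * maxn #|X1| #|X2|) ^ 4 <= _).
  by rewrite leq_exp2r.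
by rewrite expnMn leq_mul2l /= /maxn; case: ifP.
Qed.

Let BC := bipartite_cayley B.
Let P := bipartite_cayley_classes B.

Let partP : partition P BC.
Proof. by apply: equivalence_partitionP => D E F _ _ _; apply: diso_equivalence. Qed.

Let coverP : cover P = BC. Proof. exact: cover_partition partP. Qed.

Let tiP : trivIset P. Proof. by case/and3P: partP. Qed.

Let in_pblock : {in BC &, forall D E, (E \in pblock P D) = diso D E}.
Proof.
by apply: pblock_equivalence_partition => D E F _ _ _; apply: diso_equivalence.
Qed.

Lemma card_DRR_classes_le : #|DRR_classes B| <= #|P|.
Proof. by apply/subset_leq_card/subsetP=> C /setIdP[]. Qed.

(** A class outside [DRR_classes B] contains a non-DRR, so S |-> class of [cayley S] maps
    [non_DRR_sets] onto a set containing all such classes. *)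
Lemma card_classes_le : #|P| <= #|DRR_classes B| + #|non_DRR_sets|.
Proof.
rewrite -(cardsID (DRR_classes B) P) leq_add ?subset_leq_card ?subsetIr //.
apply: leq_trans (leq_imset_card (fun S => pblock P (cayley S)) _).
apply: subset_leq_card; apply/subsetP=> C /setDP[PC]; rewrite inE PC /=.
rewrite negb_forall_in => /exists_inP[D CD nD].
have : D \in BC by rewrite -coverP; apply/bigcupP; exists C.
case/imsetP=> S sS defD; apply/imsetP; exists S; first by rewrite inE sS -defD.
by rewrite -defD; apply/esym/def_pblock.
Qed.

(** By [DRR_diso_Aut], the connection sets belonging to one class of DRRs are images of a single one
    under automorphisms. *)
Lemma card_DRR_classes_ge :
  2 ^ #|~: B| <= #|non_DRR_sets| + #|DRR_classes B| * #|Aut [set: gT]|.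
Proof.
rewrite -card_powerset -(cardsID non_DRR_sets (powerset _)).
rewrite leq_add ?subset_leq_card ?subsetIr //.
pose F (C : {set digraph gT}) := [set S : {set gT} | cayley S \in C].
apply: (@leq_trans #|\bigcup_(C in DRR_classes B) F C|).
  apply: subset_leq_card; apply/subsetP=> S /setDP[sS]; rewrite inE sS /= negbK => dS.
  have BS : cayley S \in BC by apply: imset_f.
  apply/bigcupP; exists (pblock P (cayley S)); last by rewrite inE mem_pblock coverP.
  rewrite inE pblock_mem ?coverP //=; apply/forall_inP=> D DS.
  have BD : D \in BC.
    by rewrite -coverP; apply/bigcupP; exists (pblock P (cayley S)); rewrite ?pblock_mem ?coverP.
  move: DS; rewrite in_pblock //; case/imsetP: BD => S' _ -> iso.
  exact: DRR_diso iso dS.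
apply: leq_trans (card_bigcup_le _ _) _.
rewrite -sum_nat_const; apply: leq_sum => C /setIdP[PC /forall_inP dC].
have [->|[S]] := set_0Vmem (F C); first by rewrite cards0.
rewrite inE => CS; apply: leq_trans (leq_imset_card (fun a : {perm gT} => a @: S) _).
apply: subset_leq_card; apply/subsetP=> S'; rewrite inE => CS'.
have sub D : D \in C -> D \in BC by move=> CD; rewrite -coverP; apply/bigcupP; exists C.
have iso : diso (cayley S) (cayley S').
  by rewrite -in_pblock ?sub // (def_pblock tiP PC CS).
have [a aA ->] := DRR_diso_Aut iso (dC _ CS).
exact: imset_f.
Qed.
End Classes.

(** * Numerical estimates and the asymptotic conclusion *)

Lemma quadratic_le_exp2 k : 12 <= k -> 8 * k ^ 2 + 12 * k + 4 <= 2 ^ k.-1.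
Proof.
(* The induction starts at 12, where 1300 <= 2048; at 11 the inequality fails. *)
case: k => // k; rewrite ltnS -mulnn succnK; elim: k => // k IH.
rewrite leq_eqVlt => /predU1P[<- //|lt_k]; move: (IH lt_k); rewrite expnS.
by move: (2 ^ k) => m; nia.
Qed.

Lemma non_DRR_sets_small (gT : finGroupType) (B : {group gT}) k :
  abelian [set: gT] -> #|[set: gT] : B|%g = 2 -> 12 <= k -> 2 ^ k <= #|gT| < 2 ^ k.+1 ->
  #|non_DRR_sets B| * #|gT| ^ k * 2 ^ k <= 2 ^ #|~: B|.
Proof.
move=> cTT iB le_k /andP[le_kn lt_nk].
have n2v := card_setC_index2 iB.
have le_v : 2 ^ k.-1 <= #|~: B|.
  by rewrite -(leq_pmul2l (ltn0Sn 1)) -n2v -expnS prednK //; case: (k) le_k.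
rewrite -(leq_exp2r _ _ (ltn0Sn 3)) !expnMn.
apply: leq_trans (_ : 16 * (#|gT| ^ k) ^ 4 * 2 ^ (3 * #|~: B|) * (#|gT| ^ k) ^ 4 * (2 ^ k) ^ 4 <= _).
  by rewrite !leq_mul2r (card_non_DRR_sets cTT iB lt_nk) !orbT.
have le_m : #|gT| ^ k <= 2 ^ (k.+1 * k).
  by rewrite expnM; case: (k) lt_nk => // j lt_nj; rewrite leq_exp2r // ltnW.
apply: leq_trans (_ : 2 ^ 4 * (2 ^ (k.+1 * k)) ^ 4 * 2 ^ (3 * #|~: B|) * (2 ^ (k.+1 * k)) ^ 4 * (2 ^ k) ^ 4 <= _).
  by rewrite !leq_mul // leq_exp2r.
(* The exponents on the left add up to 8k^2 + 12k + 4 + 3|V|, to be compared with 4|V|. *)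
rewrite -!expnM -!expnD leq_exp2l //.
have := leq_trans (quadratic_le_exp2 le_k) le_v; rewrite -mulnn; nia.
Qed.

Import Order.TTheory GRing.Theory Num.Theory.
Local Open Scope ring_scope.

Lemma powR2_log2 (R : realType) (x : R) : 0 < x -> 2 `^ log2 x = x.
Proof.
move=> x0; rewrite /powR pnatr_eq0 /= /log2 divfK ?lnK ?posrE //.
by rewrite gt_eqF // ln_gt0 // ltr1n.
Qed.

Lemma natr_expn_le_powR (R : realType) (n k : nat) : (2 ^ k <= n)%N ->
  (n ^ k)%:R <= 2 `^ (log2 n%:R ^+ 2) :> R.
Proof.
move=> le_kn; have n0 : 0 < n%:R :> R by rewrite ltr0n (leq_trans _ le_kn) ?expn_gt0.
rewrite natrX -[X in X ^+ k](powR2_log2 n0) -powR_mulrn ?powR_ge0 // -powRrM.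
have le_kL : k%:R <= log2 n%:R :> R.
  rewrite /log2 ler_pdivlMr ?ln_gt0 ?ltr1n // mulr_natl -lnXn // ler_ln ?posrE ?exprn_gt0 //.
  by rewrite -natrX ler_nat.
rewrite ler_powR ?ler1n // expr2 ler_wpM2l //.
by apply: le_trans le_kL; rewrite ler0n.
Qed.

Theorem theorem1p6 (R : realType) :
  (forall (gT : finGroupType) (B : {group gT}),
      abelian [set: gT] -> #|[set: gT] : B|%g = 2%N ->
      2 `^ (#|gT|%:R / 2 - log2 #|gT|%:R ^+ 2) - 3 * 2 `^ (3 * #|gT|%:R / 8)
        <= #|bipartite_cayley_classes B|%:R :> R)
  /\
  (forall eps : R, 0 < eps ->
     exists N : nat, forall (gT : finGroupType) (B : {group gT}),
       abelian [set: gT] -> #|[set: gT] : B|%g = 2%N -> (N <= #|gT|)%N ->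
       `| #|DRR_classes B|%:R / #|bipartite_cayley_classes B|%:R - 1 | < eps).
Proof.
have bounds (gT : finGroupType) : (2 ^ trunc_log 2 #|gT| <= #|gT| < 2 ^ (trunc_log 2 #|gT|).+1)%N.
  by apply: trunc_log_bounds => //; rewrite -cardsT cardG_gt0.
split=> [gT B cTT iB|eps eps0].
  set k := trunc_log 2 #|gT|; have /andP[le_kn lt_nk] := bounds gT; rewrite -/k in le_kn lt_nk.
  set L := log2 _; set M := 2 `^ (3 * _ / 8); set p := #|bipartite_cayley_classes B|.
  have N0 : 0 < 2 `^ (L ^+ 2) :> R by rewrite powR_gt0.
  have nkN : (#|gT| ^ k)%:R <= 2 `^ (L ^+ 2) :> R := natr_expn_le_powR R le_kn.
  have nE : #|gT|%:R = 2 * #|~: B|%:R :> R by rewrite (card_setC_index2 iB) natrM.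
  have vE : 2 `^ (#|gT|%:R / 2) = (2 ^ #|~: B|)%:R :> R.
    rewrite nE mulrC mulKf ?pnatr_eq0 // powR_mulrn // natrX //.
  have M0 : 0 <= M := powR_ge0 _ _.
  have M4 : M ^+ 4 = (2 ^ (3 * #|~: B|))%:R.
    rewrite -powR_mulrn // -powRrM natrX -powR_mulrn //; congr (_ `^ _).
    by rewrite nE natrM; field.
  have le_x : #|non_DRR_sets B|%:R <= 2 * (#|gT| ^ k)%:R * M.
    have ge0 : 0 <= 2 * (#|gT| ^ k)%:R * M by rewrite !mulr_ge0.
    rewrite -(@ler_pXn2r _ 4) ?nnegrE // !exprMn M4 -!natrX -!natrM ler_nat.
    exact: card_non_DRR_sets cTT iB lt_nk.
  have le_2v : (2 ^ #|~: B|)%:R <= #|non_DRR_sets B|%:R + p%:R * 2 `^ (L ^+ 2) :> R.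
    apply: le_trans (_ : (#|non_DRR_sets B| + p * #|gT| ^ k)%:R <= _).
      rewrite ler_nat; apply: leq_trans (card_DRR_classes_ge B) _.
      by rewrite leq_add2l leq_mul ?card_DRR_classes_le ?card_Aut_setT.
    by rewrite natrD natrM lerD2l ler_wpM2l.
  rewrite powRB ?pnatr_eq0 ?implybT // vE lerBlDr ler_pdivrMr // mulrDl.
  apply: le_trans le_2v _; rewrite addrC lerD2l; apply: le_trans le_x _.
  have : (#|gT| ^ k)%:R * M <= 2 `^ (L ^+ 2) * M by rewrite ler_wpM2r.
  have : 0 <= 2 `^ (L ^+ 2) * M by rewrite mulr_ge0 // ltW.
  lra.
(* With t = 2 ^ k > r one has (t - 1) * eps > 1, which turns x * t <= x + p into x < eps * p. The 12
   is the threshold of [non_DRR_sets_small]. *)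
pose r := (1 + eps) / eps; pose k0 := maxn 12 (Num.bound r).
have r0 : 0 <= r by rewrite divr_ge0 ?ltW // addr_gt0.
exists (2 ^ k0)%N => gT B cTT iB le_n.
have := bounds gT; set k := trunc_log 2 #|gT| => bk; have /andP[le_kn lt_nk] := bk.
have le_k : (k0 <= k)%N by rewrite -ltnS -(ltn_exp2l _ _ (ltnSn 1)) (leq_ltn_trans le_n).
have lt_r : r < (2 ^ k)%:R.
  apply: lt_le_trans (archi_boundP r0) _; rewrite ler_nat.
  apply: leq_trans (ltnW (ltn_expl _ (ltnSn 1))) _; rewrite leq_exp2l //.
  by apply: leq_trans le_k; rewrite leq_maxr.
have small : (#|non_DRR_sets B| * #|gT| ^ k * 2 ^ k <= 2 ^ #|~: B|)%N.
  by apply: non_DRR_sets_small => //; apply: leq_trans le_k; rewrite leq_maxl.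
have ge_d := leq_trans (card_DRR_classes_ge B)
  (leq_add (leqnn _) (leq_mul (leqnn _) (card_Aut_setT lt_nk))).
have [le_dp le_p] := (card_DRR_classes_le B, card_classes_le B).
have m0 : (0 < #|gT| ^ k)%N by rewrite expn_gt0 -cardsT cardG_gt0.
have w0 : (0 < 2 ^ #|~: B|)%N by rewrite expn_gt0.
move: small ge_d le_dp le_p m0 lt_r w0.
move: #|non_DRR_sets B| #|DRR_classes B| #|bipartite_cayley_classes B| => x d p.
move: (#|gT| ^ k)%N (2 ^ k)%N (2 ^ #|~: B|)%N => m t w small ge_d le_dp le_p m0 lt_r w0.
(* Both sides are multiplied by m: m * x * t <= w <= x + d * m <= m * (x + p). *)
have le_xt : (x * t <= x + p)%N.
  rewrite -(leq_pmul2l m0); apply: (@leq_trans w); first by lia.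
  apply: leq_trans ge_d _; rewrite mulnDr leq_add ?leq_pmull // mulnC leq_mul2l.
  by rewrite le_dp orbT.
have le_xt' : x%:R * t%:R <= x%:R + p%:R :> R by rewrite -natrM -natrD ler_nat.
have lt_t : 1 + eps < t%:R * eps by rewrite -ltr_pdivrMr.
have p0 : (0 < p)%N.
  rewrite lt0n; apply: contraTneq w0 => p_0; rewrite -leqNgt.
  move: le_dp; rewrite p_0 leqn0 => /eqP d0.
  have x0 : x = 0%N.
    apply/eqP; rewrite -leqn0 leqNgt; apply/negP=> x0.
    have x0' : 0 < x%:R :> R by rewrite ltr0n.
    move: le_xt'; rewrite p_0; nra.
  by move: ge_d; rewrite x0 d0 mul0n.
have p0' : 0 < p%:R :> R by rewrite ltr0n.
have lt_x : x%:R < eps * p%:R.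
  case: x {small ge_d le_p le_xt} le_xt' => [|x] le_xt; first by rewrite mulr_gt0.
  by have : 0 < x.+1%:R :> R by []; nra.
have le_dp' : d%:R <= p%:R :> R by rewrite ler_nat.
have le_p' : p%:R <= d%:R + x%:R :> R by rewrite -natrD ler_nat.
have -> : d%:R / p%:R - 1 = - ((p%:R - d%:R) / p%:R) :> R by field; rewrite gt_eqF.
rewrite normrN ger0_norm ?divr_ge0 ?subr_ge0 // ltr_pdivrMr //.
by apply: le_lt_trans lt_x; rewrite lerBlDl.
Qed.
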